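(* Let $k\geq 2$ be an integer and, for $n\geq 0$, let $b_{k,n}$ denote the number of weakly odd-up words over $k$ of length $n$. Let $B_k(x)=\sum_{n\geq 0}b_{k,n}x^n$. Then \[B_k(x)=\begin{cases}\dfrac{1}{2(1-x)^{k/2}-1}, & \text{if } k \text{ is even};\\[2ex] \dfrac{1}{2(1-x)^{\frac{k+1}{2}}+x-1}, & \text{if } k \text{ is odd}.\end{cases}\]
   Context: For an integer $k\geq 2$, let $[k]=\{1,\ldots,k\}$. A word over $k$ of length $n$ is an element $w_1\cdots w_n\in[k]^n$ (for $n=0$ there is exactly one word, the empty word). A word $w_1\cdots w_n\in[k]^n$ is weakly odd-up if for every $i\in[n-1]$, whenever $w_i$ is odd, $w_{i+1}\geq w_i$. *)

(* Defs.v *)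
(* boolp is used only for extensionality and for the classical
   eqType/choiceType structure on formal power series. *)
From HB Require Import structures.
From mathcomp Require Import all_boot all_order all_algebra.
From mathcomp Require Import boolp.

Set Implicit Arguments.
Unset Strict Implicit.
Unset Printing Implicit Defensive.

Import GRing.Theory.
Local Open Scope ring_scope.

(* The formal power series sum_n f_n x^n, with f n for the coefficient f_n.
   A one-field record rather than [nat -> R], because function types already
   carry pointwise algebraic structures. *)
Record fps (R : Type) := Fps { fpscoef : nat -> R }.

Coercion fpscoef : fps >-> Funclass.

Lemma fpsP (R : Type) (f g : fps R) : (forall n, f n = g n) -> f = g.
Proof. by case: f g => [f] [g] /= /funext ->. Qed.

HB.instance Definition _ (R : Type) := gen_eqMixin (fps R).
HB.instance Definition _ (R : Type) := gen_choiceMixin (fps R).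

Section FpsZmodule.
Context {R : zmodType}.
Implicit Types f g : fps R.

Definition fps_zero : fps R := Fps (fun=> 0).
Definition fps_opp f := Fps (fun n => - f n).
Definition fps_add f g := Fps (fun n => f n + g n).

Fact fps_addA : associative fps_add.
Proof. by move=> f g h; apply: fpsP => n /=; rewrite addrA. Qed.

Fact fps_addC : commutative fps_add.
Proof. by move=> f g; apply: fpsP => n /=; rewrite addrC. Qed.

Fact fps_add0 : left_id fps_zero fps_add.
Proof. by move=> f; apply: fpsP => n /=; rewrite add0r. Qed.

Fact fps_addN : left_inverse fps_zero fps_opp fps_add.
Proof. by move=> f; apply: fpsP => n /=; rewrite addNr. Qed.

HB.instance Definition _ :=
  GRing.isZmodule.Build (fps R) fps_addA fps_addC fps_add0 fps_addN.

Lemma fpscoef0 n : (0 : fps R) n = 0. Proof. by []. Qed.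
Lemma fpscoefN f n : (- f) n = - f n. Proof. by []. Qed.
Lemma fpscoefD f g n : (f + g) n = f n + g n. Proof. by []. Qed.
Lemma fpscoefB f g n : (f - g) n = f n - g n. Proof. by []. Qed.

Lemma fpscoef_sum I (r : seq I) (P : pred I) (F : I -> fps R) n :
  (\sum_(i <- r | P i) F i) n = \sum_(i <- r | P i) (F i) n.
Proof. exact: (big_morph (fun f => f n) (fun f g => fpscoefD f g n)). Qed.

End FpsZmodule.

Section FpsComRing.
Context {R : comNzRingType}.
Implicit Types f g h : fps R.

Definition fps_one : fps R := Fps (fun n => (n == 0%N)%:R).
Definition fps_mul f g := Fps (fun n => \sum_(i < n.+1) f i * g (n - i)%N).

Let trunc m f : {poly R} := \poly_(i < m) f i.

Let trunc_mul m f g n : (n < m)%N -> (fps_mul f g) n = (trunc m f * trunc m g)`_n.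
Proof.
move=> ltnm; rewrite coefM; apply: eq_bigr => i _; rewrite !coef_poly.
by rewrite (leq_ltn_trans (leq_subr i n) ltnm) (leq_trans (ltn_ord i) ltnm).
Qed.

Fact fps_mulC : commutative fps_mul.
Proof.
by move=> f g; apply: fpsP => n; rewrite !(@trunc_mul n.+1) // mulrC.
Qed.

Fact fps_mulA : associative fps_mul.
Proof.
move=> f g h; apply: fpsP => n.
transitivity (trunc n.+1 f * (trunc n.+1 g * trunc n.+1 h))`_n.
  rewrite coefM; apply: eq_bigr => i _.
  by rewrite coef_poly ltn_ord -trunc_mul // ltnS leq_subr.
rewrite mulrA coefM; apply: eq_bigr => i _.
by rewrite coef_poly ltnS leq_subr -trunc_mul.
Qed.

Fact fps_mul1 : left_id fps_one fps_mul.
Proof.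
move=> f; apply: fpsP => n /=.
by rewrite big_ord_recl /= mul1r subn0 big1 ?addr0 // => i _; rewrite mul0r.
Qed.

Fact fps_mulDl : left_distributive fps_mul fps_add.
Proof.
move=> f g h; apply: fpsP => n /=.
by rewrite -big_split; apply: eq_bigr => i _; rewrite mulrDl.
Qed.

Fact fps_one_neq0 : fps_one != 0.
Proof.
by apply/eqP => /(congr1 (fun f => f 0%N))/eqP; rewrite /= oner_eq0.
Qed.

HB.instance Definition _ := GRing.Zmodule_isComNzRing.Build (fps R)
  fps_mulA fps_mulC fps_mul1 fps_mulDl fps_one_neq0.

Definition fpsX : fps R := Fps (fun n => (n == 1%N)%:R).

Lemma fpscoef1 n : (1 : fps R) n = (n == 0%N)%:R. Proof. by []. Qed.
Lemma fpscoefX n : fpsX n = (n == 1%N)%:R. Proof. by []. Qed.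
Lemma fpscoefM f g n : (f * g) n = \sum_(i < n.+1) f i * g (n - i)%N.
Proof. by []. Qed.

Lemma fpscoef0M f g : (f * g) 0%N = f 0%N * g 0%N.
Proof. by rewrite fpscoefM big_ord1. Qed.

Lemma fpscoef_exp_small f n m : f 0%N = 0 -> (m < n)%N -> (f ^+ n) m = 0.
Proof.
move=> f0; elim: n m => // n IHn m ltmn; rewrite exprS fpscoefM big_ord_recl.
rewrite f0 mul0r add0r big1 // => -[i /= ltim] _.
by rewrite IHn ?mulr0 // /bump /=; case: m ltmn ltim => // m; rewrite ltnS;
  move=> lemn _; rewrite subSS (leq_ltn_trans (leq_subr _ _)).
Qed.

End FpsComRing.

Section FpsUnitRing.
Context {R : comUnitRingType}.
Implicit Types f g : fps R.

Definition fps_unit : {pred fps R} := [pred f : fps R | f 0%N \is a GRing.unit].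

(* If f_0 = c is a unit then f = c (1 - u) with u_0 = 0, so that
   1/f = c^-1 (1 + u + u^2 + ...), where u^j does not contribute to the
   coefficients of index < j. *)
Definition fps_inv f : fps R :=
  if f \in fps_unit then
    let u := Fps (fun n => (n != 0%N)%:R * - ((f 0%N)^-1 * f n)) in
    Fps (fun n => (f 0%N)^-1 * (\sum_(j < n.+1) u ^+ j) n)
  else f.

Lemma fps_geom_sum_coef (u : fps R) m n : u 0%N = 0 -> (m <= n)%N ->
  (\sum_(j < n.+1) u ^+ j) m = (\sum_(j < m.+1) u ^+ j) m.
Proof.
move=> u0 lemn; rewrite -(subnKC lemn) -addSn big_split_ord fpscoefD /=.
rewrite [X in _ + X]fpscoef_sum [X in _ + X]big1 ?addr0 // => j _.
by rewrite fpscoef_exp_small //= leq_addr.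
Qed.

Fact fps_mulVf : {in fps_unit, left_inverse 1 fps_inv *%R}.
Proof.
move=> f fU; rewrite /fps_inv fU; move: fU; rewrite inE => f0U.
set u := Fps (fun n => (n != 0%N)%:R * _).
have u0 : u 0%N = 0 by rewrite /= mul0r.
have uE n : f n = f 0%N * (1 - u) n.
  rewrite fpscoefB fpscoef1 /=; case: n => [|n] /=.
    by rewrite mul0r subr0 mulr1.
  by rewrite mul1r sub0r opprK mulVKr.
rewrite mulrC; apply: fpsP => n.
transitivity (((1 - u) * \sum_(j < n.+1) u ^+ j) n).
  rewrite !fpscoefM; apply: eq_bigr => i _.
  rewrite (@fps_geom_sum_coef u (n - i) n) ?leq_subr // (uE i).
  by rewrite -[X in _ * X = _]/((f 0%N)^-1 * (_ : R)) mulrACA divrr ?mul1r.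
rewrite -opprB mulNr -subrX1 opprB fpscoefB (@fpscoef_exp_small _ u) //.
by rewrite subr0.
Qed.

Fact fps_unitPl f g : g * f = 1 -> fps_unit f.
Proof.
move=> /(congr1 (fun h : fps R => h 0%N)); rewrite fpscoef0M fpscoef1 /= => gf1.
by apply/unitrPr; exists (g 0%N); rewrite mulrC.
Qed.

Fact fps_inv_out : {in [predC fps_unit], fps_inv =1 id}.
Proof. by move=> f /negPf fU; rewrite /fps_inv fU. Qed.

HB.instance Definition _ := GRing.ComNzRing_hasMulInverse.Build (fps R)
  fps_mulVf fps_unitPl fps_inv_out.

Lemma fps_unitE f : (f \is a GRing.unit) = (f 0%N \is a GRing.unit).
Proof. by []. Qed.

End FpsUnitRing.

(* 'I_k is {0, ..., k-1}, whereas the letters are 1, ..., k: parity must be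
   read off the shifted value. *)
Definition letter (k : nat) (a : 'I_k) : nat := a.+1.

Definition weakly_odd_up (k n : nat) (w : n.-tuple 'I_k) : bool :=
  [forall i : 'I_n, forall j : 'I_n, (j == i.+1 :> nat) ==>
    odd (letter (tnth w i)) ==> (letter (tnth w i) <= letter (tnth w j))%N].

Definition odd_up_number (k n : nat) : nat :=
  #|[set w : n.-tuple 'I_k | weakly_odd_up w]|.

Definition odd_up_series (k : nat) : fps rat :=
  Fps (fun n => (odd_up_number k n)%:R).

(* Main.v *)
(** For a letter [a] let [F_a] count the words [w] such that [a w] is weakly
    odd-up, and put [S_t = 1 + x * sum_(b >= t) F_b].  Even letters impose
    nothing on their successor, so [F_a = B] for them, while [F_a = S_a] for odd
    [a]; also [S_1 = B] and [S_(k+1) = 1].  Hence [S_(a+1) = (1 - x) S_a] for odd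
    [a] and [S_(a+1) = S_a - x B] for even [a], so passing from [S_a] to [S_(a+2)]
    with [a] odd multiplies [S_a + B] by [1 - x]. *)
Require Import Defs.
From mathcomp Require Import all_boot all_order all_algebra.
From mathcomp Require Import ring.

Import GRing.Theory.
Local Open Scope ring_scope.

Lemma fpscoefXM (R : comNzRingType) (f : fps R) n :
  (fpsX * f) n = if n is m.+1 then f m else 0.
Proof.
rewrite fpscoefM big_ord_recl fpscoefX mul0r add0r.
case: n => [|n]; first by rewrite big_ord0.
rewrite big_ord_recl /= mul1r subSS subn0 big1 ?addr0 // => i _.
by rewrite mul0r.
Qed.

Lemma big_tuple_cons (R : nmodType) (T : finType) n (F : n.+1.-tuple T -> R) :
  \sum_w F w = \sum_a \sum_(w : n.-tuple T) F (cons_tuple a w).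
Proof.
rewrite pair_bigA.
rewrite (reindex (fun p : T * n.-tuple T => cons_tuple p.1 p.2)) //=.
exists (fun w => (thead w, behead_tuple w)) => [[a w] _|w _] /=.
  by congr (_, _); apply: val_inj.
by rewrite [RHS]tuple_eta; apply: val_inj.
Qed.

(** With [odd_up_rel k] as [r] this is $F_a$; the letter [a] does not count towards the length. *)
Definition path_series {T : finType} (r : rel T) (a : T) : fps rat :=
  Fps (fun n => #|[set w : n.-tuple T | path r a w]|%:R).

(** Split off the first letter [b] of a nonempty word; what remains is a path from [b]. The empty
    word gives the 1. *)
Lemma path_series_rec (T : finType) (r : rel T) (a : T) :
  path_series r a = 1 + fpsX * \sum_(b | r a b) path_series r b.
Proof.
have coefE b n : path_series r b n = \sum_(w : n.-tuple T) (path r b w)%:R.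
  rewrite /= cardsE -sum1_card natr_sum big_mkcond; apply: eq_bigr => w _.
  by rewrite unfold_in; case: (path r b w).
apply: fpsP => n; rewrite fpscoefD fpscoef1 fpscoefXM coefE.
case: n => [|n].
  rewrite (big_pred1 [tuple]) ?addr0 //= => w.
  by symmetry; apply/eqP; exact: tuple0.
rewrite add0r fpscoef_sum big_tuple_cons [RHS]big_mkcond; apply: eq_bigr => b _ /=.
case: ifP => rab; last by rewrite big1.
by rewrite -[RHS]/(path_series r b n) coefE.
Qed.

Definition odd_up_rel (k : nat) : rel 'I_k :=
  fun a b => odd (letter a) ==> (letter a <= letter b)%N.

Lemma weakly_odd_upE (k n : nat) (w : n.-tuple 'I_k) :
  weakly_odd_up w = sorted (odd_up_rel k) w.
Proof.
case: n w => [|n] w.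
  by rewrite tuple0; apply/forallP => -[].
(* A default value for [nth], available because the word is nonempty here. *)
have x0 := tnth w ord0.
apply/forallP/(sortedP x0) => [wP i|wP i].
  rewrite size_tuple => lti.
  have /forallP/(_ (Ordinal lti)) := wP (Ordinal (ltnW lti)).
  by rewrite eqxx /= !(tnth_nth x0).
apply/forallP => j; apply/implyP => /eqP ji.
have := wP i; rewrite size_tuple -ji ltn_ord => /(_ isT).
by rewrite !(tnth_nth x0).
Qed.

(** Prepending a letter that allows every successor adds no constraint. This serves for the even
    letters and for the letter 1, the least one. *)
Lemma odd_up_seriesE (k : nat) (a : 'I_k) :
  (forall b, odd_up_rel k a b) -> odd_up_series k = path_series (odd_up_rel k) a.
Proof.
move=> ra; apply: fpsP => n; congr (_%:R); apply: eq_card => w.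
rewrite !inE weakly_odd_upE.
by case: (tval w) => //= b s; rewrite ra.
Qed.

Definition tail_series (k t : nat) : fps rat :=
  1 + fpsX * \sum_(b : 'I_k | (t <= b)%N) path_series (odd_up_rel k) b.

Lemma tail_seriesS {k : nat} (a : 'I_k) :
  tail_series k a = tail_series k a.+1 + fpsX * path_series (odd_up_rel k) a.
Proof.
rewrite /tail_series (bigD1 a) //= mulrDr -addrA; congr (_ + _).
rewrite [LHS]addrC; congr (_ * _ + _); apply: eq_bigl => b.
by rewrite ltn_neqAle eq_sym andbC.
Qed.

Lemma tail_series_size (k : nat) : tail_series k k = 1.
Proof.
by rewrite /tail_series big_pred0 ?mulr0 ?addr0 // => b; rewrite leqNgt ltn_ord.
Qed.

(* Indices count from 0, so [t] stands for the letter [t + 1]. *)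
Lemma tail_series_even {k t : nat} : (t < k)%N -> ~~ odd t ->
  tail_series k t.+1 = (1 - fpsX) * tail_series k t.
Proof.
move=> ltk ev; have /= := tail_seriesS (Ordinal ltk).
have -> : path_series (odd_up_rel k) (Ordinal ltk) = tail_series k t.
  rewrite path_series_rec; congr (_ + _ * _); apply: eq_bigl => b.
  by rewrite /odd_up_rel /letter /= ev.
by move=> E; rewrite mulrBl mul1r {1}E addrK.
Qed.

Lemma tail_series_odd (k t : nat) : (t < k)%N -> odd t ->
  tail_series k t.+1 = tail_series k t - fpsX * odd_up_series k.
Proof.
move=> ltk od; have /= := tail_seriesS (Ordinal ltk).
rewrite -odd_up_seriesE; last by move=> b; rewrite /odd_up_rel /letter /= od.
by move=> ->; rewrite addrK.
Qed.

Lemma tail_series0 (k : nat) : (0 < k)%N -> tail_series k 0 = odd_up_series k.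
Proof.
move=> k0; rewrite (@odd_up_seriesE _ (Ordinal k0)) // path_series_rec.
by congr (_ + _ * _); apply: eq_bigl => b.
Qed.

(** The factor 2 comes from $S_1 + B = 2B$ at [j = 0]. *)
Lemma tail_series_double (k j : nat) : (0 < k)%N -> (j.*2 <= k)%N ->
  tail_series k j.*2 + odd_up_series k = 2 * (1 - fpsX) ^+ j * odd_up_series k.
Proof.
move=> k0; elim: j => [_|j IHj].
  by rewrite double0 tail_series0 // expr0; ring.
rewrite doubleS => ltk.
rewrite tail_series_odd ?tail_series_even /= ?odd_double //; last exact: ltnW.
have := IHj (ltnW (ltnW ltk)); rewrite exprS.
move: (tail_series _ _) (odd_up_series _) (_ ^+ j) => S B Y E.
(* Two steps turn $S$ into $(1-x)S - xB$, and adding $B$ gives $(1-x)(S+B)$. *)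
by transitivity ((1 - fpsX) * (S + B)); [|rewrite E]; ring.
Qed.

Theorem theorem6 (k : nat) (hk : (2 <= k)%N) :
  odd_up_series k =
    if ~~ odd k then 1 / (2 * (1 - fpsX) ^+ (k %/ 2) - 1)
    else 1 / (2 * (1 - fpsX) ^+ ((k + 1) %/ 2) + fpsX - 1).
Proof.
have k0 : (0 < k)%N := ltnW hk.
have lek : (k./2.*2 <= k)%N by rewrite -[leqRHS]odd_double_half leq_addl.
have E := tail_series_double k k./2 k0 lek.
rewrite addn1 !divn2 /= uphalf_half.
(* It remains to show that the denominator times the series is 1. *)
case: ifP => [ek|/negbFE ok]; rewrite div1r; symmetry; apply: mulr1_eq.
  (* For even [k], [E] reads $1 + B = 2(1-x)^{k/2}B$. *)
  by move: E; rewrite even_halfK // tail_series_size => E; rewrite mulrBl -E mul1r addrK.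
(* For odd [k], [E] stops at the even index [k - 1]; one more factor $1-x$ leads to
   [tail_series k k], which is 1. *)
have kE : k./2.*2.+1 = k by rewrite odd_halfK // prednK.
have := @tail_series_even k k./2.*2; rewrite kE leqnn odd_double tail_series_size.
move=> /(_ isT isT); rewrite ok add1n exprS.
move: (tail_series _ _) (odd_up_series _) (_ ^+ _) E => S B Y E S1; rewrite [RHS]S1.
by transitivity ((1 - fpsX) * (2 * Y * B - B)); [ring|rewrite -E addrK].
Qed.
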